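(* Let $\mathcal{S}$ be a sample of $m$ examples, let $\mathcal{U} = \{\sigma_1,\dots,\sigma_n\} \subseteq \{-1,1\}^m$, and let $\pi_j = \pi_{\sigma_j}$, $j=1,\dots,n$, be the corresponding rados. Run the algorithm RadoBoost on $\{\pi_1,\dots,\pi_n\}$ for $T \geq 1$ rounds. Suppose the weak learning assumption holds: there is $\gamma > 0$ such that for all $t \geq 1$, the feature $\iota(t)$ returned by the weak feature index oracle satisfies $|r_t| \geq \gamma$. Then the output $\theta_T$ after $T$ rounds satisfies $$F^{r}_{\exp}(\mathcal{S}, \theta_T, \mathcal{U}) \;\leq\; \exp\left(-T\gamma^2/2\right).$$
   Context: $\mathcal{S} = \{(x_i,y_i) : i=1,\dots,m\}$ with $x_i \in \mathbb{R}^d$, $y_i \in \{-1,1\}$. For $\sigma \in \{-1,1\}^m$ the rado is $\pi_\sigma = \frac12 \sum_{i=1}^m (\sigma_i + y_i) x_i \in \mathbb{R}^d$. The exponential rado-risk is $F^{r}_{\exp}(\mathcal{S},\theta,\mathcal{U}) = \frac1n \sum_{\sigma \in \mathcal{U}} \exp(-\theta^\top \pi_\sigma)$. Algorithm RadoBoost: input rados $\pi_1,\dots,\pi_n \in \mathbb{R}^d$ and $T \geq 1$. Let $\pi_{jk}$ denote coordinate $k$ of $\pi_j$ and $\pi_{*k} = \max_j |\pi_{jk}|$. Initialize weights $w_1 = (1/n)\mathbf{1} \in \mathbb{R}^n$. For $t = 1,\dots,T$: (1) an oracle (given the rados and $w_t$) returns a feature index $\iota(t) \in \{1,\dots,d\}$;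 (2) set $$r_t = \frac{1}{\pi_{*\iota(t)}} \sum_{j=1}^n w_{tj}\, \pi_{j\iota(t)}, \qquad \alpha_t = \frac{1}{2\pi_{*\iota(t)}} \log\frac{1+r_t}{1-r_t};$$ (3) for $j=1,\dots,n$ set $$w_{(t+1)j} = w_{tj} \cdot \frac{1 - r_t \pi_{j\iota(t)}/\pi_{*\iota(t)}}{1-r_t^2}.$$ Output $\theta_T \in \mathbb{R}^d$ with coordinates $\theta_{Tk} = \sum_{t : \iota(t)=k} \alpha_t$ for $k = 1,\dots,d$. All quantities are assumed well defined, i.e. $\pi_{*\iota(t)} > 0$ and $|r_t| < 1$ at every round. *)

(* Defs.v *)
From HB Require Import structures.
From mathcomp Require Import all_boot all_order all_algebra.
From mathcomp Require Import reals sequences exp.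
Set Implicit Arguments.
Unset Strict Implicit.
Unset Printing Implicit Defensive.
Import Order.TTheory GRing.Theory Num.Theory.
Local Open Scope ring_scope.

(** Elements of {-1, 1} are encoded as booleans, [b] standing for [(-1) ^+ b]:
    [false] is 1 and [true] is -1.  Thus {-1, 1}^m is the finite type
    [signs m], and its subsets are the [{set signs m}]. *)
Definition signs (m : nat) := {ffun 'I_m -> bool}.

(** [S i] is the pair (x_i, y_i). *)
Definition sample (R : realType) (d m : nat) := 'I_m -> 'cV[R]_d * bool.

Definition rado (R : realType) (d m : nat) (S : sample R d m) (s : signs m) :
    'cV[R]_d :=
  2^-1 *: \sum_(i < m) ((-1) ^+ s i + (-1) ^+ (S i).2) *: (S i).1.

Definition exp_rado_risk (R : realType) (d m : nat) (S : sample R d m)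
    (theta : 'cV[R]_d) (U : {set signs m}) : R :=
  #|U|%:R^-1 * \sum_(s in U) expR (- (theta^T *m rado S s) 0 0).

(** The default value 0 of the maximum is harmless (absolute values are
    nonnegative) and only matters when there are no rados. *)
Definition max_abs_coord (R : realType) (d n : nat) (pi : 'I_n -> 'cV[R]_d)
    (k : 'I_d) : R :=
  \big[Num.max/0]_(j < n) `|pi j k 0|.

(** [r_t], [alpha_t] and [w_(t+1)] in terms of the weights [w] of a round and
    the feature [k] returned by the oracle in that round. *)
Definition edge (R : realType) (d n : nat) (pi : 'I_n -> 'cV[R]_d)
    (w : 'rV[R]_n) (k : 'I_d) : R :=
  (max_abs_coord pi k)^-1 * \sum_(j < n) w 0 j * pi j k 0.

Definition leverage (R : realType) (d n : nat) (pi : 'I_n -> 'cV[R]_d)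
    (w : 'rV[R]_n) (k : 'I_d) : R :=
  let r := edge pi w k in
  (2 * max_abs_coord pi k)^-1 * ln ((1 + r) / (1 - r)).

Definition reweight (R : realType) (d n : nat) (pi : 'I_n -> 'cV[R]_d)
    (w : 'rV[R]_n) (k : 'I_d) : 'rV[R]_n :=
  let r := edge pi w k in
  \row_(j < n)
    (w 0 j * ((1 - r * pi j k 0 / max_abs_coord pi k) / (1 - r ^+ 2))).

(** The round number is an argument of the oracle, so that its answer need not
    be a fixed function of the rados and the weights (it may be randomized or
    depend on the past). *)
Definition feature_oracle (R : realType) (d n : nat) :=
  nat -> ('I_n -> 'cV[R]_d) -> 'rV[R]_n -> 'I_d.

Fixpoint weights_after (R : realType) (d n : nat) (oracle : feature_oracle R d n)
    (pi : 'I_n -> 'cV[R]_d) (t : nat) : 'rV[R]_n :=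
  if t is t'.+1 then
    let w := weights_after oracle pi t' in reweight pi w (oracle t pi w)
  else const_mx n%:R^-1.

(** Rounds are numbered from 1: [w_t] is the weight vector obtained after
    [t - 1] rounds.  The value at [t = 0] is never used. *)
Definition rb_weights (R : realType) (d n : nat) (oracle : feature_oracle R d n)
    (pi : 'I_n -> 'cV[R]_d) (t : nat) : 'rV[R]_n :=
  weights_after oracle pi t.-1.

Definition rb_feature (R : realType) (d n : nat) (oracle : feature_oracle R d n)
    (pi : 'I_n -> 'cV[R]_d) (t : nat) : 'I_d :=
  oracle t pi (rb_weights oracle pi t).

Definition rb_edge (R : realType) (d n : nat) (oracle : feature_oracle R d n)
    (pi : 'I_n -> 'cV[R]_d) (t : nat) : R :=
  edge pi (rb_weights oracle pi t) (rb_feature oracle pi t).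

Definition rb_leverage (R : realType) (d n : nat) (oracle : feature_oracle R d n)
    (pi : 'I_n -> 'cV[R]_d) (t : nat) : R :=
  leverage pi (rb_weights oracle pi t) (rb_feature oracle pi t).

Definition rado_boost (R : realType) (d n : nat) (oracle : feature_oracle R d n)
    (pi : 'I_n -> 'cV[R]_d) (T : nat) : 'cV[R]_d :=
  \col_(k < d)
    \sum_(1 <= t < T.+1 | rb_feature oracle pi t == k) rb_leverage oracle pi t.

(* Main.v *)
Require Import Defs.
From HB Require Import structures.
From mathcomp Require Import all_boot all_order all_algebra.
From mathcomp Require Import reals sequences exp.
From mathcomp Require Import interval_inference convex ring lra.
Set Implicit Arguments.
Unset Strict Implicit.
Unset Printing Implicit Defensive.
Import Order.TTheory GRing.Theory Num.Theory.
Local Open Scope ring_scope.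

(** Each round replaces the factor [expR (- alpha_t * pi_jk)] by a multiple of
    the reweighting factor of the j-th rado: convexity of the exponential at
    the points [ln (1 + r)] and [ln (1 - r)] gives
    [expR (- alpha * pi_jk) <= w_(t+1)j / w_tj * sqrt (1 - r ^+ 2)].  Since the
    weights keep total mass 1, the risk is at most the product over t of
    [sqrt (1 - r_t ^+ 2)], hence at most that of [expR (- r_t ^+ 2 / 2)]. *)

Section ReweightingBound.
Variable R : realType.
Implicit Types r x : R.

(** The exponent is the convex combination of [ln (1 + r)] and [ln (1 - r)] with weights
    [(1 - x) / 2] and [(1 + x) / 2]; the same combination of [1 + r] and [1 - r] is [1 - r * x]. *)
Lemma expR_ln_ratio_le r x : `|r| < 1 -> `|x| <= 1 ->
  expR (- (x / 2 * ln ((1 + r) / (1 - r))) + ln (1 - r ^+ 2) / 2) <= 1 - r * x.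
Proof.
rewrite ltr_norml ler_norml => /andP[r_gtN1 r_lt1] /andP[x_geN1 x_le1].
have r1_gt0 : 0 < 1 + r by lra.
have r2_gt0 : 0 < 1 - r by lra.
have -> : 1 - r ^+ 2 = (1 + r) * (1 - r) by ring.
rewrite ln_div ?posrE// lnM ?posrE//.
have x0 : 0 <= (1 - x) / 2 by lra.
have x1 : (1 - x) / 2 <= 1 by lra.
have := convex_expR (Itv01 x0 x1) (ln (1 + r)) (ln (1 - r)).
rewrite !convRE /= /unstable.onem !lnK ?posrE//.
set p := ln (1 + r); set q := ln (1 - r) => cvx.
have -> : - (x / 2 * (p - q)) + (p + q) / 2 =
  (1 - x) / 2 * p + (1 - (1 - x) / 2) * q by field.
by apply: (le_trans cvx); rewrite le_eqVlt; apply/orP; left; apply/eqP; field.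
Qed.

Lemma expR_ln_ratio_le_edge (gamma r x : R) :
  0 <= gamma -> gamma <= `|r| -> `|r| < 1 -> `|x| <= 1 ->
  expR (- (x / 2 * ln ((1 + r) / (1 - r))))
    <= (1 - r * x) / (1 - r ^+ 2) * expR (- (gamma ^+ 2 / 2)).
Proof.
move=> gamma_ge0 gamma_le r_lt1 x_le1.
have sq_lt1 : r ^+ 2 < 1 by rewrite -real_normK ?num_real// expr_lt1.
have D_gt0 : 0 < 1 - r ^+ 2 by rewrite subr_gt0.
have := expR_ln_ratio_le r_lt1 x_le1.
set a := - (x / 2 * _); set b := ln (1 - r ^+ 2) => le_ab.
have D_eq : 1 - r ^+ 2 = expR b by rewrite lnK ?posrE.
have b_le : b <= - gamma ^+ 2.
  apply: (@le_trans _ _ (- r ^+ 2)); first by apply: le_ln1Dx; rewrite ltrN2.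
  by rewrite lerN2 -(real_normK (num_real r)) ler_sqr ?nnegrE.
rewrite D_eq -expRN -mulrA -expRD.
(* The part [a + b / 2] is bounded by [le_ab]; for the rest, [- (b / 2) <= - b - gamma ^+ 2 / 2] is
   [b_le] halved. *)
have -> : a = a + b / 2 + (- (b / 2)) by ring.
rewrite [leLHS]expRD; apply: ler_pM; rewrite ?expR_ge0// ler_expR.
lra.
Qed.

End ReweightingBound.

Section Rounds.
Variables (R : realType) (d n : nat) (pi : 'I_n -> 'cV[R]_d).
Implicit Types (w : 'rV[R]_n) (k : 'I_d).

Lemma normalized_coord_le1 k j :
  0 < max_abs_coord pi k -> `|pi j k 0 / max_abs_coord pi k| <= 1.
Proof.
move=> M_gt0; rewrite normrM normfV (gtr0_norm M_gt0) ler_pdivrMr// mul1r.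
exact: le_bigmax.
Qed.

(** By definition of the edge [r], the numerators sum to [1 - r * r], which the normalization
    cancels. *)
Lemma sum_reweight w k :
  0 < max_abs_coord pi k -> `|edge pi w k| < 1 -> \sum_j w 0 j = 1 ->
  \sum_j reweight pi w k 0 j = 1.
Proof.
move=> M_gt0 r_lt1 w1.
have D_neq0 : 1 - edge pi w k ^+ 2 != 0.
  by rewrite gt_eqF// subr_gt0 -real_normK ?num_real// expr_lt1.
under eq_bigr do rewrite mxE mulrA; rewrite -mulr_suml.
under eq_bigr => j _.
  have -> : w 0 j * (1 - edge pi w k * pi j k 0 / max_abs_coord pi k) =
    w 0 j - edge pi w k * (max_abs_coord pi k)^-1 * (w 0 j * pi j k 0) by ring.
  over.
rewrite sumrB w1 -mulr_sumr -mulrA -[_^-1 * \sum_(i < n) _]/(edge pi w k).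
by rewrite -expr2 mulfV.
Qed.

(** This is the scalar bound at [x = pi j k 0 / max_abs_coord pi k]. *)
Lemma leverage_factor_le w k j (gamma : R) :
  0 <= gamma -> 0 < max_abs_coord pi k -> `|edge pi w k| < 1 ->
  gamma <= `|edge pi w k| -> 0 <= w 0 j ->
  w 0 j * expR (- (leverage pi w k * pi j k 0))
    <= reweight pi w k 0 j * expR (- (gamma ^+ 2 / 2)).
Proof.
move=> gamma_ge0 M_gt0 r_lt1 gamma_le w_ge0.
rewrite mxE -mulrA; apply: ler_wpM2l => //.
have := expR_ln_ratio_le_edge gamma_ge0 gamma_le r_lt1
  (normalized_coord_le1 j M_gt0).
rewrite mulrA /leverage; congr (expR (- _) <= _).
by field; rewrite gt_eqF.
Qed.

(** The case [gamma = 0] of the previous bound: the new weight dominates a nonnegative product. *)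
Lemma reweight_ge0 w k j :
  0 < max_abs_coord pi k -> `|edge pi w k| < 1 -> 0 <= w 0 j ->
  0 <= reweight pi w k 0 j.
Proof.
move=> M_gt0 r_lt1 w_ge0.
have := leverage_factor_le (lexx 0) M_gt0 r_lt1 (normr_ge0 _) w_ge0.
move/(le_trans (mulr_ge0 w_ge0 (expR_ge0 _))).
by rewrite pmulr_lge0 ?expR_gt0.
Qed.

Variable oracle : feature_oracle R d n.

(** The one-round bounds multiply up along the rounds. Nonnegativity is carried through the
    induction because each one-round bound is scaled by the current weight. *)
Lemma weights_after_bound (gamma : R) t j : 0 <= gamma ->
  (forall s, (1 <= s <= t)%N ->
    [/\ 0 < max_abs_coord pi (rb_feature oracle pi s),
        `|rb_edge oracle pi s| < 1 & gamma <= `|rb_edge oracle pi s|]) ->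
  0 <= weights_after oracle pi t 0 j /\
  n%:R^-1 * expR (- \sum_(1 <= s < t.+1)
      rb_leverage oracle pi s * pi j (rb_feature oracle pi s) 0)
    <= weights_after oracle pi t 0 j * expR (- (t%:R * gamma ^+ 2 / 2)).
Proof.
move=> gamma_ge0; elim: t => [|t IH] H.
  rewrite /= mxE invr_ge0 ler0n big_geq// !oppr0 mul0r mul0r oppr0.
  by split.
have [|w_ge0 IHt] := IH.
  by move=> s /andP[s1 st]; apply: H; rewrite s1 leqW.
have /H[M_gt0 r_lt1 gamma_le] : (1 <= t.+1 <= t.+1)%N by rewrite leqnn.
(* By computation, [rb_weights] at round [t.+1] is [weights_after] at [t], so the one-round lemmas
   apply directly. *)
split; first exact: reweight_ge0.
rewrite big_nat_recr//= opprD expRD mulrA.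
have -> : - (t.+1%:R * gamma ^+ 2 / 2) =
  - (gamma ^+ 2 / 2) - t%:R * gamma ^+ 2 / 2 by rewrite -addn1 natrD; ring.
rewrite expRD mulrA.
apply: (le_trans (ler_wpM2r (expR_ge0 _) IHt)).
rewrite mulrAC; apply: ler_wpM2r; first exact: expR_ge0.
exact: leverage_factor_le.
Qed.

Lemma sum_weights_after t : (0 < n)%N ->
  (forall s, (1 <= s <= t)%N ->
     0 < max_abs_coord pi (rb_feature oracle pi s)) ->
  (forall s, (1 <= s <= t)%N -> `|rb_edge oracle pi s| < 1) ->
  \sum_j weights_after oracle pi t 0 j = 1.
Proof.
move=> n_gt0; elim: t => [|t IH] M_gt0 r_lt1 /=.
  under eq_bigr do rewrite mxE.
  by rewrite sumr_const card_ord -[LHS]mulr_natl mulfV// pnatr_eq0 -lt0n.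
have last_round : (1 <= t.+1 <= t.+1)%N by rewrite leqnn.
apply: sum_reweight (M_gt0 _ last_round) (r_lt1 _ last_round) _.
by apply: IH => s /andP[s1 st]; [apply: M_gt0|apply: r_lt1]; rewrite s1 leqW.
Qed.

(** Exchanging the sums over coordinates and rounds leaves, for each round, only the coordinate of
    its feature. *)
Lemma rado_boost_dot T (v : 'cV[R]_d) :
  ((rado_boost oracle pi T)^T *m v) 0 0 =
  \sum_(1 <= t < T.+1) rb_leverage oracle pi t * v (rb_feature oracle pi t) 0.
Proof.
rewrite mxE; under eq_bigr do rewrite !mxE mulr_suml.
rewrite (exchange_big_dep xpredT)//=; apply: eq_bigr => t _.
by under eq_bigl do rewrite eq_sym; rewrite big_pred1_eq.
Qed.

End Rounds.

Theorem lemma4 (R : realType) (d m n : nat) (S : sample R d m)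
    (U : {set signs m}) (sigma : 'I_n -> signs m)
    (sigma_inj : injective sigma)
    (U_def : U = [set sigma j | j : 'I_n])
    (pi : 'I_n -> 'cV[R]_d)
    (pi_def : forall j : 'I_n, pi j = rado S (sigma j))
    (oracle : feature_oracle R d n)
    (T : nat) (T_ge1 : (1 <= T)%N)
    (max_gt0 : forall t : nat, (1 <= t <= T)%N ->
       0 < max_abs_coord pi (rb_feature oracle pi t))
    (edge_lt1 : forall t : nat, (1 <= t <= T)%N -> `|rb_edge oracle pi t| < 1)
    (gamma : R) (gamma_gt0 : 0 < gamma)
    (weak_learning : forall t : nat, (1 <= t <= T)%N ->
       gamma <= `|rb_edge oracle pi t|) :
  exp_rado_risk S (rado_boost oracle pi T) U
    <= expR (- (T%:R * gamma ^+ 2 / 2)).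
Proof.
have n_gt0 : (0 < n)%N.
  (* Without rados the maximum takes its default value 0, contradicting its positivity at round
     1. *)
  rewrite lt0n; apply/eqP => n0.
  have /max_gt0 : (1 <= 1 <= T)%N by [].
  rewrite /max_abs_coord big_pred0 ?ltxx// => j.
  by have := ltn_ord j; rewrite [X in (_ < X)%N]n0.
have rounds_ok t : (1 <= t <= T)%N ->
    [/\ 0 < max_abs_coord pi (rb_feature oracle pi t),
        `|rb_edge oracle pi t| < 1 & gamma <= `|rb_edge oracle pi t|].
  by move=> tT; split; [exact: max_gt0|exact: edge_lt1|exact: weak_learning].
rewrite /exp_rado_risk U_def card_imset// card_ord.
rewrite big_imset /=; last by move=> i j _ _; exact: sigma_inj.
rewrite mulr_sumr.
(* Writing 1 as the total final weight turns the right side into a sum over rados, to be compared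
   term by term. *)
rewrite -[leRHS]mul1r
  -[X in _ <= X * _](sum_weights_after n_gt0 max_gt0 edge_lt1) mulr_suml.
rewrite (eq_bigl xpredT)//; apply: ler_sum => j _; rewrite -pi_def rado_boost_dot.
by have [] := weights_after_bound j (ltW gamma_gt0) rounds_ok.
Qed.
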